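(* Consider the discrete-time multiple-input multiple-output (MIMO) faster-than-Nyquist (FTN) channel described in the context, with $L$ transmit antennas, $K$ receive antennas, channel matrix $\tilde{H}\in\mathbb{C}^{K\times L}$, raised cosine pulse $g(t)$ with roll-off factor $\beta\in[0,1]$, symbol period $T>0$, acceleration factor $\delta\in(0,1]$, noise level $\sigma_0^2>0$ and power budget $P>0$. Let $\tau_1,\dots,\tau_L\ge 0$ be the eigenvalues of $\tilde{H}^\dagger\tilde{H}$, let $\mu>0$ be the solution of $$\sigma_0^2\sum_{i=1}^{L}\Big(\frac{1}{\mu}-\frac{1}{\tau_i}\Big)^+=P\,\delta T,$$ and set $\bar{\alpha}^{(i)}=\sigma_0^2\big(\frac{1}{\mu}-\frac{1}{\tau_i}\big)^+$ for $i=1,\dots,L$. If $\delta(1+\beta)\ge 1$, then the capacity of this MIMO FTN channel is $$C=\sum_{i=1}^{L}\log_2\!\big(1+\sigma_0^{-2}\bar{\alpha}^{(i)}\tau_i\big)\quad\text{bits per channel use},$$ and, since $1/(\delta T)$ symbols per second are sent over a bandwidth $(1+\beta)/(2T)$, the capacity in bit/s/Hz is $$\bar{C}=\frac{1}{\delta(1+\beta)}\sum_{i=1}^{L}\log_2\!\big(1+\sigma_0^{-2}\bar{\alpha}^{(i)}\tau_i\big).$$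
   Context: Notation: $\dagger$ is conjugate transpose, $\otimes$ the Kronecker product, $I_n$ the $n\times n$ identity, $(a)^+=\max(a,0)$, with the convention $(\frac1\mu-\frac10)^+=0$. The pulse $g(t)$ is a raised cosine pulse, $g(t)=p(t)\star p^*(-t)$ for a unit-energy root raised cosine pulse $p$, with Fourier transform $G(f)=T$ for $|f|\le\frac{1-\beta}{2T}$, $G(f)=\frac{T}{2}\big[1+\cos\big(\frac{\pi T}{\beta}(|f|-\frac{1-\beta}{2T})\big)\big]$ for $\frac{1-\beta}{2T}<|f|\le\frac{1+\beta}{2T}$, and $0$ otherwise. Write $g[n]=g(n\delta T)$ and, for a block length $N$, let $G_N\in\mathbb{C}^{N\times N}$ be the Hermitian Toeplitz matrix with entries $(G_N)_{n,m}=g[n-m]$. Channel model (matched filter outputs at all $K$ receive antennas, sampled every $\delta T$, for $N$ symbols per transmit antenna): $Y=(\tilde{H}\otimes G_N)A+\Omega$, where $A\in\mathbb{C}^{LN}$ stacks the $L$ antennas' symbol vectors, is zero-mean circularly symmetric complex Gaussian with covariance $\Sigma_A$ (an $LN\times LN$ positive semidefinite matrix), and $\Omega$ is independent zero-mean circularly symmetric complex Gaussian noise with covariance $\Sigma_\Omega=\sigma_0^2(I_K\otimes G_N)$. Then $\Sigma_Y=(\tilde{H}\otimes G_N)\Sigma_A(\tilde{H}\otimes G_N)^\dagger+\sigma_0^2(I_K\otimes G_N)$. The transmit power of the FTN signal is $\frac{1}{N\delta T}\mathrm{tr}\big((I_L\otimes G_N)\Sigma_A\big)$ and is constrained to be at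 most $P$. The capacity is defined as $$C=\lim_{N\to\infty}\ \max_{\Sigma_A\succeq 0:\ \frac{1}{N\delta T}\mathrm{tr}((I_L\otimes G_N)\Sigma_A)\le P}\ \frac{1}{N}\log_2\frac{\det\Sigma_Y}{\det\Sigma_\Omega}\quad\text{(bits per channel use)}.$$
   Formalization: A rate of 1/(δT) symbols per second over bandwidth (1+β)/(2T) would give the factor 2/(δ(1+β)), not the stated 1/(δ(1+β)); here the capacity in bit/s/Hz is taken as C multiplied by 1/(δ(1+β)), that is, with the two-sided bandwidth (1+β)/T. *)

(* Defs.v *)
From HB Require Import structures.
From mathcomp Require Import all_boot all_order all_algebra.
From mathcomp Require Import all_classical all_reals all_analysis.
From mathcomp Require Import sesquilinear spectral.
From mathcomp Require Import complex mxtens.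

Set Implicit Arguments.
Unset Strict Implicit.
Unset Printing Implicit Defensive.

Import Order.TTheory GRing.Theory Num.Theory.
Local Open Scope ring_scope.
Local Open Scope classical_set_scope.
Local Open Scope sesquilinear_scope.

Section FTN.
Variable R : realType.

Definition rc_spectrum (beta T f : R) : R :=
  if `|f| <= (1 - beta) / (2 * T) then T
  else if `|f| <= (1 + beta) / (2 * T) then
    T / 2 * (1 + cos (pi * T / beta * (`|f| - (1 - beta) / (2 * T))))
  else 0.

(* g(t) = inverse Fourier transform of G:  \int G(f) e^{2 pi i f t} df.
   G is real and even, so this equals \int G(f) cos(2 pi f t) df. *)
Definition rc_pulse (beta T t : R) : R :=
  Rintegral lebesgue_measure [set: R]
    (fun f => rc_spectrum beta T f * cos (2 * pi * f * t)).

Definition rc_sample (beta T delta : R) (n : int) : R :=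
  rc_pulse beta T (n%:~R * delta * T).

Definition GN (beta T delta : R) (N : nat) : 'M[R[i]]_N :=
  \matrix_(n < N, m < N) (rc_sample beta T delta (n%:Z - m%:Z))%:C%C.

Definition psd (n : nat) (A : 'M[R[i]]_n) : Prop :=
  A ^t* = A /\ forall v : 'cV[R[i]]_n, 0 <= (v ^t* *m A *m v) ord0 ord0.

Definition log2 (x : R) : R := ln x / ln 2.

(* (1/mu - 1/tau)^+ with the convention (1/mu - 1/0)^+ = 0 *)
Definition wf_pos (mu tau : R) : R :=
  if tau == 0 then 0 else Num.max (mu^-1 - tau^-1) 0.

Definition ftn_rate (K L N : nat) (H : 'M[R[i]]_(K, L)) (beta T delta sigma2 : R)
    (SA : 'M[R[i]]_(L * N)) : R :=
  let G := GN beta T delta N in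
  let HG := H *t G in
  let SY := HG *m SA *m HG ^t* + sigma2%:C%C *: (1%:M *t G) in
  let SO := sigma2%:C%C *: ((1%:M : 'M[R[i]]_K) *t G) in
  N%:R^-1 * log2 (complex.Re (\det SY / \det SO)).

Definition ftn_feasible (L N : nat) (beta T delta P : R)
    (SA : 'M[R[i]]_(L * N)) : Prop :=
  psd SA /\
  (N%:R * delta * T)%:C%C^-1 *
     \tr (((1%:M : 'M[R[i]]_L) *t GN beta T delta N) *m SA) <= P%:C%C.

Definition ftn_cap_N (K L N : nat) (H : 'M[R[i]]_(K, L)) (beta T delta sigma2 P : R)
    : \bar R :=
  ereal_sup [set (@ftn_rate K L N H beta T delta sigma2 SA)%:E
            | SA in [set SA : 'M[R[i]]_(L * N) | @ftn_feasible L N beta T delta P SA]].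

End FTN.

(* Main.v *)
(* For every N >= 1 the N-th maximum equals the claimed limit exactly.  G_N is
   positive definite: for real a, a^T G_N a is the integral over f of
   G(f) |sum_n a_n e^(2 pi i f n delta T)|^2, where G > 0 on |f| <= 1/(2T) and a
   nonzero trigonometric polynomial has finitely many zeros there.  Write G_N = B' B
   and H' H = U' diag(tau) U, the prime denoting the conjugate transpose.  By
   det (1 + X Y) = det (1 + Y X), the ratio of determinants is
   det (1 + sigma^-2 W Sigma_A W') for W = (diag(sqrt tau) U) (x) B, while the power
   is the trace of Q = V Sigma_A V' for V = U (x) B.  So G_N disappears and one is
   left with N copies of L parallel Gaussian channels.  The upper bound is AM-GM on
   the eigenvalues, after scaling by the water-filling optimum, together with the
   optimality conditions of water-filling; it is attained by Sigma_A = X X' with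
   X = (U' diag(sqrt alpha)) (x) B^-1. *)
Require Import Defs.
From HB Require Import structures.
From mathcomp Require Import all_boot all_order all_algebra.
From mathcomp Require Import all_classical all_reals all_analysis.
From mathcomp Require Import sesquilinear spectral.
From mathcomp Require Import complex mxtens.
From mathcomp Require Import measurable_realfun ring lra.
Set Implicit Arguments.
Unset Strict Implicit.
Unset Printing Implicit Defensive.
Import Order.TTheory GRing.Theory Num.Theory.
Import numFieldNormedType.Exports.
Local Open Scope ring_scope.
Local Open Scope classical_set_scope.
Local Open Scope sesquilinear_scope.

(** * Positive semidefinite matrices, determinants and Kronecker products *)

Section PositiveSemidefinite.
Variable C : numClosedFieldType.

(* [psd] over an arbitrary closed field: over [R[i]] both are convertible, but
   unification is much faster on an abstract field. *)
Definition psdmx n (A : 'M[C]_n) : Prop :=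
  A ^t* = A /\ forall v : 'cV[C]_n, 0 <= (v ^t* *m A *m v) 0 0.

(** Both sides are the determinant of one block matrix, factored into block triangular matrices in
    two ways. *)
Lemma det_add1_mulmxC (F : comPzRingType) m n (A : 'M[F]_(m, n)) (B : 'M[F]_(n, m)) :
  \det (1%:M + A *m B) = \det (1%:M + B *m A).
Proof.
have E1 : block_mx 1%:M (- A) B 1%:M =
    block_mx 1%:M 0 B 1%:M *m block_mx 1%:M (- A) 0 (1%:M + B *m A).
  rewrite mulmx_block !mul1mx !mul0mx !mulmx1 !addr0.
  by rewrite mulmxN addrCA addNr addr0.
have E2 : block_mx 1%:M (- A) B 1%:M =
    block_mx 1%:M (- A) 0 1%:M *m block_mx (1%:M + A *m B) 0 B 1%:M.
  rewrite mulmx_block !mul1mx !mul0mx !mulmx1 !add0r.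
  by rewrite mulNmx addrK.
have := congr1 determinant E1; rewrite {}E2 !det_mulmx !det_ublock !det_lblock.
by rewrite !det1 !mul1r !mulr1.
Qed.

Lemma trmxC_mul m n p (A : 'M[C]_(m, n)) (B : 'M[C]_(n, p)) :
  (A *m B) ^t* = B ^t* *m A ^t*.
Proof. by rewrite trmx_mul map_mxM. Qed.

Lemma trmxC_tens m n p q (A : 'M[C]_(m, n)) (B : 'M[C]_(p, q)) :
  (A *t B) ^t* = A ^t* *t B ^t*.
Proof. by rewrite trmx_tens map_mxT. Qed.

Lemma trmxC1 n : (1%:M : 'M[C]_n) ^t* = 1%:M.
Proof. by rewrite trmx1 map_mx1. Qed.

Lemma diag_trmxC n (d : 'rV[C]_n) : (forall i, 0 <= d 0 i) ->
  (diag_mx d) ^t* = diag_mx d.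
Proof.
move=> d0; rewrite tr_diag_mx map_diag_mx; congr diag_mx.
by apply/rowP => i; rewrite !mxE; apply/CrealP/ger0_real.
Qed.

Lemma tensmx11 (F : comPzRingType) m n : (1%:M : 'M[F]_m) *t (1%:M : 'M[F]_n) = 1%:M.
Proof.
apply/matrixP => i j.
case: (mxtens_indexP i) => i1 i2; case: (mxtens_indexP j) => j1 j2.
rewrite tensmxE !mxE (can_eq (@mxtens_indexK _ _)) xpair_eqE.
by case: (i1 == j1); case: (i2 == j2); rewrite ?mulr0 ?mul0r ?mulr1.
Qed.

Lemma diag_tens1 (F : comPzRingType) m n (d : 'rV[F]_m) :
  diag_mx d *t (1%:M : 'M[F]_n) = diag_mx (\row_k d 0 (mxtens_unindex k).1).
Proof.
apply/matrixP => i j.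
case: (mxtens_indexP i) => i1 i2; case: (mxtens_indexP j) => j1 j2.
rewrite tensmxE !mxE !(can_eq (@mxtens_indexK _ _)) !mxtens_indexK xpair_eqE /=.
by case: (i1 == j1); case: (i2 == j2); rewrite ?mulr0 ?mul0r ?mulr1.
Qed.

(** Each index of the left Kronecker factor occurs [n] times; this is where the [N] copies of every
    channel are counted. *)
Lemma big_mxtens_unindex (T : Type) (idx : T) (op : Monoid.com_law idx) m n
    (F : 'I_m -> T) :
  \big[op/idx]_(k < m * n) F (mxtens_unindex k).1 =
  \big[op/idx]_(i < m) \big[op/idx]_(j < n) F i.
Proof.
rewrite pair_big (reindex (@mxtens_index m n)).
  by apply: eq_bigr => -[i j] _; rewrite mxtens_indexK.
by exists (@mxtens_unindex m n) => x _; rewrite (mxtens_indexK, mxtens_unindexK).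
Qed.

Lemma psd_congr m n (B : 'M[C]_(m, n)) (A : 'M[C]_n) :
  psdmx A -> psdmx (B *m A *m B ^t*).
Proof.
move=> [Ah Ap]; split; first by rewrite !trmxC_mul trmxCK Ah mulmxA.
by move=> v; have := Ap (B ^t* *m v); rewrite trmxC_mul trmxCK !mulmxA.
Qed.

Lemma psd1 n : psdmx (1%:M : 'M[C]_n).
Proof.
split; first exact: trmxC1.
move=> v; rewrite mulmx1 mxE sumr_ge0 // => i _.
by rewrite !mxE mulrC mul_conjC_ge0.
Qed.

Lemma psd_gram m n (B : 'M[C]_(m, n)) : psdmx (B *m B ^t*).
Proof. by have := @psd_congr _ _ B _ (psd1 n); rewrite mulmx1. Qed.

Lemma psd_add n (A B : 'M[C]_n) : psdmx A -> psdmx B -> psdmx (A + B).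
Proof.
move=> [Ah Ap] [Bh Bp]; split; first by rewrite linearD map_mxD /= Ah Bh.
by move=> v; rewrite mulmxDr mulmxDl mxE addr_ge0.
Qed.

Lemma psd_scale n (a : C) (A : 'M[C]_n) : 0 <= a -> psdmx A -> psdmx (a *: A).
Proof.
move=> a0 [Ah Ap]; split.
  by rewrite linearZ map_mxZ /= Ah (CrealP (ger0_real a0)).
by move=> v; rewrite -scalemxAr -scalemxAl mxE mulr_ge0.
Qed.

Lemma psd_diag_ge0 n (A : 'M[C]_n) i : psdmx A -> 0 <= A i i.
Proof.
move=> [_ /(_ (delta_mx i 0))].
rewrite trmx_delta map_delta_mx -rowE -colE.
by rewrite !mxE.
Qed.

(** A Hermitian matrix is normal, so the spectral theorem applies; the eigenvalues are diagonal
    entries of the semidefinite matrix [U *m A *m U ^t*], hence nonnegative. *)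
Lemma psd_spectral n (A : 'M[C]_n) : psdmx A ->
  exists (U : 'M[C]_n) (d : 'rV[C]_n),
    [/\ U *m U ^t* = 1%:M, U ^t* *m U = 1%:M, forall i, 0 <= d 0 i
      & A = U ^t* *m diag_mx d *m U].
Proof.
move=> psdA; have [Ah _] := psdA.
have UU : spectralmx A *m (spectralmx A) ^t* = 1%:M.
  by apply/unitarymxP/spectral_unitarymx.
have nA : A \is normalmx by apply/normalmxP; rewrite Ah.
have AE := orthomx_spectralP nA.
rewrite invmx_unitary ?spectral_unitarymx // in AE.
set U := spectralmx A in UU AE *; set d := spectral_diag A in AE *.
exists U, d; split => //; first exact: mulmx1C.
move=> i; have := @psd_diag_ge0 _ _ i (@psd_congr _ _ U _ psdA).
by rewrite AE !mulmxA UU mul1mx -mulmxA UU mulmx1 mxE eqxx.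
Qed.

(** By AM-GM the product of the eigenvalues is at most the [n]-th power of their mean, which is
    [\tr A / n]. *)
Lemma psd_det_le1 n (A : 'M[C]_n) : psdmx A -> \tr A <= n%:R -> \det A <= 1.
Proof.
(* The mean of the eigenvalues needs a positive dimension. *)
case: n A => [|n] A; first by rewrite det_mx00.
move=> /psd_spectral[U [d [UU U'U d0 ->]]].
rewrite mxtrace_mulC mulmxA UU mul1mx mxtrace_diag => trd.
have dU : \det (U ^t*) * \det U = 1 by rewrite -det_mulmx U'U det1.
rewrite !det_mulmx mulrAC dU mul1r det_diag.
have d0' : {in 'I_n.+1, forall i, 0 <= d 0 i} by [].
apply: (le_trans (leif_AGM d0')).
rewrite card_ord exprn_ile1 //.
  by rewrite divr_ge0 // sumr_ge0.
by rewrite ler_pdivrMr ?ltr0n // mul1r.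
Qed.

(** Scaling both sides of [A] by [diag(y^(-1/2))] reduces to trace at most [n] and divides the
    determinant by the product of the [y i]. The bound is tight at [A = diag(y)], so [y] is later
    taken from the water-filling optimum. *)
Lemma psd_det_le_prod n (A : 'M[C]_n) (y : 'I_n -> C) : psdmx A ->
  (forall i, 0 < y i) -> \sum_i A i i / y i <= n%:R -> \det A <= \prod_i y i.
Proof.
move=> psdA y0 Ay.
pose D := diag_mx (\row_i (sqrtC (y i))^-1).
have r0 i : 0 <= (sqrtC (y i))^-1 by rewrite invr_ge0 sqrtC_ge0 ltW.
have DD : D ^t* = D by apply: diag_trmxC => i; rewrite mxE.
have D2 i : (sqrtC (y i))^-1 * (sqrtC (y i))^-1 = (y i)^-1.
  by rewrite -invfM -expr2 sqrtCK.
have : \det (D *m A *m D ^t*) <= 1.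
  apply: psd_det_le1; first exact: psd_congr.
  apply: le_trans Ay; rewrite DD /mxtrace le_eqVlt; apply/orP; left; apply/eqP.
  apply: eq_bigr => i _; rewrite -mulmxA mul_diag_mx mul_mx_diag !mxE.
  by rewrite mulrCA D2.
rewrite DD !det_mulmx mulrAC -det_mulmx det_mulmx det_diag -big_split /=.
under eq_bigr do rewrite mxE D2.
by rewrite prodfV mulrC ler_pdivrMr ?mul1r ?prodr_gt0.
Qed.

Lemma psd_gram_exists n (A : 'M[C]_n) : psdmx A ->
  exists B : 'M[C]_n, A = B ^t* *m B.
Proof.
move=> /psd_spectral[U [d [UU U'U d0 ->]]].
pose E := diag_mx (\row_i sqrtC (d 0 i)).
have EE : E ^t* = E by apply: diag_trmxC => i; rewrite mxE sqrtC_ge0.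
exists (E *m U); rewrite trmxC_mul EE !mulmxA -(mulmxA _ E E) mulmx_diag.
congr (_ *m diag_mx _ *m _); apply/rowP => i.
by rewrite !mxE -expr2 sqrtCK.
Qed.

End PositiveSemidefinite.

(** * Determinant ratio under the power constraint: upper bound and attainment *)

Section WaterFilling.
Variable C : numClosedFieldType.
Variables (K L N : nat) (H : 'M[C]_(K, L)) (U : 'M[C]_L) (tau : 'I_L -> C).
Variables (G B : 'M[C]_N) (s : C).
Hypothesis s0 : 0 < s.
Hypothesis tau0 : forall i, 0 <= tau i.
Hypothesis UU : U *m U ^t* = 1%:M.
Hypothesis HH : H ^t* *m H = U ^t* *m diag_mx (\row_i tau i) *m U.
Hypothesis GE : G = B ^t* *m B.
Hypothesis Gu : G \in unitmx.

Let sqrt_tau := diag_mx (\row_i sqrtC (tau i)).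
Let W := (sqrt_tau *m U) *t B.

Let sqrt_tau_trmxC : sqrt_tau ^t* = sqrt_tau.
Proof. by apply: diag_trmxC => i; rewrite mxE sqrtC_ge0. Qed.

Let HHE : H ^t* *m H = (sqrt_tau *m U) ^t* *m (sqrt_tau *m U).
Proof.
rewrite HH trmxC_mul sqrt_tau_trmxC !mulmxA -(mulmxA _ sqrt_tau sqrt_tau).
rewrite mulmx_diag; congr (_ *m diag_mx _ *m _).
by apply/rowP => i; rewrite !mxE -expr2 sqrtCK.
Qed.

(** The noise covariance is factored out on the right, which cancels one [G]. Swapping factors
    inside the determinant brings [H ^t* *m H] and [G] together as the Gram matrix of [W]; a second
    swap restores a Hermitian form. *)
Lemma det_ratio_whitened (SA : 'M[C]_(L * N)) :
  \det ((H *t G) *m SA *m (H *t G) ^t* + s *: (1%:M *t G)) /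
  \det (s *: ((1%:M : 'M[C]_K) *t G)) = \det (1%:M + s^-1 *: (W *m SA *m W ^t*)).
Proof.
have Gh : G ^t* = G by rewrite GE trmxC_mul trmxCK.
have sG_unit : s *: ((1%:M : 'M[C]_K) *t G) \in unitmx.
  have : (s *: ((1%:M : 'M[C]_K) *t G)) *m (s^-1 *: (1%:M *t invmx G)) = 1%:M.
    rewrite -scalemxAl -scalemxAr scalerA divff ?gt_eqF // scale1r.
    by rewrite tensmx_mul mulmx1 mulmxV // tensmx11.
  by move=> sGV; have [] := mulmx1_unit sGV.
have -> : (H *t G) *m SA *m (H *t G) ^t* + s *: (1%:M *t G) =
    (1%:M + s^-1 *: ((H *t G) *m SA *m (H ^t* *t 1%:M))) *m (s *: (1%:M *t G)).
  rewrite mulmxDl mul1mx addrC; congr (_ + _).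
  rewrite -scalemxAl -scalemxAr scalerA mulVf ?gt_eqF // scale1r -[RHS]mulmxA.
  by rewrite tensmx_mul mulmx1 mul1mx trmxC_tens Gh.
rewrite det_mulmx mulfK; last by rewrite -unitfE -unitmxE.
rewrite scalemxAr det_add1_mulmxC.
rewrite -scalemxAl mulmxA tensmx_mul mul1mx HHE GE -tensmx_mul.
rewrite -trmxC_tens -/W -[_ ^t* *m _ *m _]mulmxA.
by rewrite scalemxAr det_add1_mulmxC -scalemxAl.
Qed.

Let trace_whitened (SA : 'M[C]_(L * N)) :
  \tr ((U *t B) *m SA *m (U *t B) ^t*) = \tr ((1%:M *t G) *m SA).
Proof.
rewrite -mulmxA mxtrace_mulC -mulmxA trmxC_tens tensmx_mul (mulmx1C UU) -GE.
by rewrite mxtrace_mulC.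
Qed.

Variables (alpha : 'I_L -> C) (mu : C).
Hypothesis alpha0 : forall i, 0 <= alpha i.
Hypothesis mu0 : 0 <= mu.

Let y i := 1 + s^-1 * alpha i * tau i.

Let y0 i : 0 < y i.
Proof. by rewrite ltr_wpDr // !mulr_ge0 ?invr_ge0 // ltW. Qed.

(* Optimality conditions of the water-filling problem: [mu] is the multiplier
   of the power constraint, and the slope of [log (1 + x tau i / s)] at
   [alpha i] is at most [mu / s], with equality on the active channels. *)
Hypothesis kkt_le : forall i, tau i <= mu * y i.
Hypothesis kkt_eq : forall i, tau i * alpha i = mu * y i * alpha i.

(** After whitening, only diagonal entries matter. Relative to [y], each lies below an affine
    function of the power [Q k k] that equals 1 at the optimal power, and the power constraint makes
    the sum of the deviations nonpositive. *)
Lemma det_ratio_le (SA : 'M[C]_(L * N)) : psdmx SA ->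
  \tr ((1%:M *t G) *m SA) <= N%:R * \sum_i alpha i ->
  \det ((H *t G) *m SA *m (H *t G) ^t* + s *: (1%:M *t G)) /
  \det (s *: ((1%:M : 'M[C]_K) *t G)) <= \prod_i y i ^+ N.
Proof.
move=> psdSA; rewrite -trace_whitened det_ratio_whitened.
set Q := (U *t B) *m SA *m (U *t B) ^t* => trQ.
have psdQ : psdmx Q by exact: psd_congr.
have sV0 : 0 <= s^-1 by rewrite invr_ge0 ltW.
have -> : \prod_i y i ^+ N = \prod_(k < L * N) y (mxtens_unindex k).1.
  rewrite (big_mxtens_unindex _ _ y).
  by apply: eq_bigr => i _; rewrite prodr_const card_ord.
apply: psd_det_le_prod => //.
  apply: psd_add; [exact: psd1 | apply: psd_scale => //; exact: psd_congr].
have WE : W *m SA *m W ^t* = (sqrt_tau *t 1%:M) *m Q *m (sqrt_tau *t 1%:M) ^t*.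
  rewrite /Q !mulmxA tensmx_mul mul1mx -/W -!mulmxA; congr (_ *m (_ *m _)).
  by rewrite -trmxC_mul tensmx_mul mul1mx.
have WQ k : (W *m SA *m W ^t*) k k = tau (mxtens_unindex k).1 * Q k k.
  rewrite WE trmxC_tens trmxC1 sqrt_tau_trmxC diag_tens1 -mulmxA mul_diag_mx.
  rewrite mul_mx_diag !mxE mulrCA mulrC; congr (_ * _).
  by rewrite -expr2 sqrtCK.
pose a (k : 'I_(L * N)) := alpha (mxtens_unindex k).1.
(* A tangent-line bound at the optimum: [s^-1 * mu] is the multiplier, and [Q k k - a k] is the
   excess of the power over the water-filling allocation. *)
have le1 k : (1%:M + s^-1 *: (W *m SA *m W ^t*)) k k / y (mxtens_unindex k).1 <=
    1 + s^-1 * mu * (Q k k - a k).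
  rewrite ler_pdivrMr // mxE [X in _ + X]mxE WQ mxE eqxx /a.
  move: (mxtens_unindex k).1 => i.
  have -> : (1 + s^-1 * mu * (Q k k - alpha i)) * y i =
      y i + s^-1 * (mu * y i) * Q k k - s^-1 * (mu * y i * alpha i).
    by move: (y i) (s^-1) => z t; ring.
  have -> : y i + s^-1 * (mu * y i) * Q k k - s^-1 * (mu * y i * alpha i) =
      1 + s^-1 * (mu * y i) * Q k k.
    (* Complementary slackness turns the subtracted term into [s^-1 * tau i * alpha i], which is
       [y i - 1]. *)
    by rewrite -kkt_eq {1}/y; move: (mu * y i) s^-1 => z t; ring.
  rewrite lerD2l -mulrA ler_wpM2l // ler_wpM2r //; exact: psd_diag_ge0.
apply: le_trans (ler_sum _ (fun k _ => le1 k)) _.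
rewrite big_split /= sumr_const card_ord -mulr_sumr gerDl.
apply: mulr_ge0_le0; first by rewrite mulr_ge0.
rewrite sumrB subr_le0; apply: le_trans trQ _.
rewrite /a (big_mxtens_unindex _ _ alpha) mulr_sumr ler_sum // => i _.
by rewrite sumr_const card_ord mulr_natl.
Qed.

Lemma det_ratio_attained : exists SA : 'M[C]_(L * N),
  [/\ psdmx SA, \tr ((1%:M *t G) *m SA) = N%:R * \sum_i alpha i
  & \det ((H *t G) *m SA *m (H *t G) ^t* + s *: (1%:M *t G)) /
    \det (s *: ((1%:M : 'M[C]_K) *t G)) = \prod_i y i ^+ N].
Proof.
have Bu : B \in unitmx by move: Gu; rewrite GE unitmx_mul => /andP[].
pose sqrt_alpha := diag_mx (\row_i sqrtC (alpha i)).
have aa : sqrt_alpha ^t* = sqrt_alpha.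
  by apply: diag_trmxC => i; rewrite mxE sqrtC_ge0.
(* [invmx B] undoes the coloring by [G] and [U ^t*] aligns the powers with the eigenvectors, so both
   power and determinant reduce to diagonal matrices. *)
pose X := (U ^t* *m sqrt_alpha) *t invmx B.
exists (X *m X ^t*).
have UBX : (U *t B) *m X = sqrt_alpha *t 1%:M.
  by rewrite tensmx_mul mulmxA UU mul1mx mulmxV.
have WX : W *m X = (sqrt_tau *m sqrt_alpha) *t 1%:M.
  by rewrite tensmx_mul -mulmxA (mulmxA U) UU mul1mx mulmxV.
split; first exact: psd_gram.
  rewrite -trace_whitened !mulmxA UBX -mulmxA -trmxC_mul UBX trmxC_tens aa trmxC1.
  rewrite tensmx_mul mulmx1 mulmx_diag diag_tens1 mxtrace_diag.
  under eq_bigr do rewrite !mxE -expr2 sqrtCK.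
  rewrite (big_mxtens_unindex _ _ alpha) mulr_sumr; apply: eq_bigr => i _.
  by rewrite sumr_const card_ord mulr_natl.
rewrite det_ratio_whitened !mulmxA WX -mulmxA -trmxC_mul WX trmxC_tens trmxC1.
rewrite trmxC_mul aa sqrt_tau_trmxC tensmx_mul mulmx1 !mulmx_diag diag_tens1.
have -> : 1%:M = diag_mx (const_mx 1) :> 'M[C]_(L * N) by rewrite diag_const_mx.
rewrite -linearZ -linearD /= det_diag.
transitivity (\prod_(k < L * N) y (mxtens_unindex k).1).
  apply: eq_bigr => k _; rewrite !mxE /y /=; move: (Ordinal _) => i.
  rewrite -[s^-1 * _ * _]mulrA; congr (1 + _ * _).
  by rewrite -[in RHS](sqrtCK (alpha i)) -[in RHS](sqrtCK (tau i)); ring.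
rewrite (big_mxtens_unindex _ _ y).
by apply: eq_bigr => i _; rewrite prodr_const card_ord.
Qed.

End WaterFilling.

(** * The raised cosine spectrum and the positive definiteness of [GN] *)

Lemma Rintegral_sum d (T : measurableType d) (R : realType)
    (m : {measure set T -> \bar R}) (D : set T) (I : Type) (r : seq I)
    (F : I -> T -> R) :
  measurable D -> (forall i, m.-integrable D (EFin \o F i)) ->
  \int[m]_(x in D) (\sum_(i <- r) F i x) = \sum_(i <- r) \int[m]_(x in D) F i x.
Proof.
move=> mD iF; elim: r => [|i r IH].
  rewrite big_nil; under eq_Rintegral do rewrite big_nil.
  by rewrite Rintegral_cst // mul0r.
rewrite big_cons -IH -RintegralD //.
  by apply: eq_Rintegral => x _; rewrite big_cons.
apply: eq_integrable (integrable_sum mD r (fun j _ => iF j)) => // x _ /=.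
by rewrite sumEFin.
Qed.

Section Pulse.
Variables (R : realType) (beta T : R).
Hypothesis beta01 : 0 <= beta <= 1.
Hypothesis T0 : 0 < T.
Local Notation mu := (@lebesgue_measure R).
Local Notation G := (rc_spectrum beta T).

Lemma rc_spectrum_ge0 f : 0 <= G f.
Proof.
rewrite /rc_spectrum; case: ifP => _; first exact: ltW.
by case: ifP => // _; rewrite mulr_ge0 ?divr_ge0 ?(ltW T0) // -lerBlDl sub0r cos_geN1.
Qed.

Lemma rc_spectrum_le f : G f <= T.
Proof.
rewrite /rc_spectrum; case: ifP => // _.
case: ifP => _; last exact: ltW.
rewrite -[leRHS](divfK (x := 2)) ?pnatr_eq0 // ler_wpM2l ?divr_ge0 // ?(ltW T0) //.
by rewrite -[2](natrD _ 1 1) lerD2l cos_le1.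
Qed.

(** Up to the frequency [1/(2T)] the roll-off cosine has its argument in [[0, pi/2]], so it is
    nonnegative and [1 + cos] is positive. *)
Lemma rc_spectrum_gt0 f : `|f| <= (2 * T)^-1 -> 0 < G f.
Proof.
move=> fT; rewrite /rc_spectrum; case: ifPn => //; rewrite -ltNge => f1.
have [b0 b1] := andP beta01.
(* For [beta = 0] the flat part already reaches [1/(2T)], so the roll-off case forces [beta > 0] and
   the division by [beta] is genuine. *)
have bpos : 0 < beta.
  rewrite lt_neqAle b0 andbT; apply: contraTneq f1 => <-.
  by rewrite subr0 mul1r -leNgt.
have T20 : 0 < 2 * T by rewrite mulr_gt0.
rewrite ifT; last first.
  by rewrite (le_trans fT) // ler_pdivlMr // mulVf ?gt_eqF // lerDl.
rewrite mulr_gt0 ?divr_gt0 // ltr_wpDr //; apply: cos_ge0_pihalf.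
set e := `|f| - _.
have e0 : 0 <= e by rewrite subr_ge0 ltW.
have eb : e <= beta / (2 * T).
  rewrite lerBlDr (le_trans fT) // -mulrDl addrC subrK mul1r //.
have c0 : 0 < pi * T / beta by rewrite divr_gt0 // mulr_gt0 ?pi_gt0.
apply/andP; split.
  apply: (@le_trans _ _ 0); first by rewrite oppr_le0 divr_ge0 // pi_ge0.
  by rewrite mulr_ge0 // ltW.
apply: le_trans (ler_wpM2l (ltW c0) eb) _.
rewrite le_eqVlt; apply/orP; left; apply/eqP; field.
by rewrite !gt_eqF.
Qed.

Lemma rc_spectrum_support f : T^-1 < `|f| -> G f = 0.
Proof.
have [b0 b1] := andP beta01.
have T20 : 0 < 2 * T by rewrite mulr_gt0.
move=> fT; have f2 : (1 + beta) / (2 * T) < `|f|.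
  apply: le_lt_trans fT; rewrite ler_pdivrMr // mulrCA mulVf ?gt_eqF // mulr1.
  by rewrite -[2](natrD _ 1 1) lerD2l.
rewrite /rc_spectrum !ifF //; apply/negbTE; rewrite -ltNge //.
apply: le_lt_trans f2; rewrite ler_wpM2r ?invr_ge0 ?(ltW T20) //.
by rewrite lerD2l; lra.
Qed.

Lemma measurable_rc_spectrum : measurable_fun [set: R] G.
Proof.
have mN : measurable_fun [set: R] (fun f : R => `|f|) by exact: normr_measurable.
apply: measurable_fun_ifT; first exact: measurable_fun_ler.
  exact: measurable_cst.
apply: measurable_fun_ifT; first exact: measurable_fun_ler.
  apply: measurable_funM; first exact: measurable_cst.
  apply: measurable_funD; first exact: measurable_cst.
  apply: measurableT_comp.
    by apply: continuous_measurable_fun; exact: continuous_cos.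
  apply: measurable_funM; first exact: measurable_cst.
  by apply: measurable_funB => //; exact: measurable_cst.
exact: measurable_cst.
Qed.

(** The product is measurable, bounded by [T * M], and vanishes outside [[-1/T, 1/T]] because
    [1 + beta <= 2]. *)
Lemma integrable_rc_spectrumM (h : R -> R) (M : R) : continuous h ->
  (forall f, `|h f| <= M) -> mu.-integrable [set: R] (EFin \o (fun f => G f * h f)).
Proof.
move=> ch hM; pose D : set R := `[- T^-1, T^-1].
have M0 : 0 <= M by apply: le_trans (hM 0).
have mGh : measurable_fun [set: R] (fun f => G f * h f).
  apply: measurable_funM; first exact: measurable_rc_spectrum.
  exact: continuous_measurable_fun.
have -> : EFin \o (fun f => G f * h f) = (EFin \o (fun f => G f * h f)) \_ D.
  apply/funext => f; rewrite /patch; case: ifPn => //= fD.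
  rewrite rc_spectrum_support ?mul0r // ltNge.
  apply: contra fD => fT; rewrite inE /D /= in_itv /=.
  by rewrite -ler_norml.
have mD : measurable D by exact: measurable_itv.
apply: (iffLR (integrable_mkcond _ _)) => //.
apply: measurable_bounded_integrable => //.
- by rewrite /= lebesgue_measure_itv /=; case: ifP => // _; rewrite ltry.
- exact: measurable_funS mGh.
- exists (T * M); split; first exact: num_real.
  move=> x Mx f _; apply: le_trans (ltW Mx).
  rewrite normrM ger0_norm ?rc_spectrum_ge0 // ler_pM ?rc_spectrum_ge0 //.
  exact: rc_spectrum_le.
Qed.

Variables (delta : R).
Hypothesis delta01 : 0 < delta <= 1.
(** The phase gained by frequency [f] over one sampling interval. *)
Let theta (f : R) := 2 * pi * f * (delta * T).

Let cont_theta (g : R -> R) (k : R) : continuous g ->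
  continuous (fun f => g (k * theta f)).
Proof.
move=> cg f; apply: (@continuous_comp _ _ _ (fun f => k * theta f) g); last exact: cg.
have -> : (fun f => k * theta f) = *%R (k * (2 * pi) * (delta * T)).
  by apply/funext => x; rewrite /theta; ring.
exact: mulrl_continuous.
Qed.

Section Quadratic.
Variables (N : nat) (a : 'I_N -> R).
(** The squared modulus of the trigonometric polynomial [sum_n a_n e^(i n theta)], kept in real
    form. *)
Let q f := (\sum_(n < N) a n * cos (n%:R * theta f)) ^+ 2 +
           (\sum_(n < N) a n * sin (n%:R * theta f)) ^+ 2.

Let qE f : q f =
  \sum_(n < N) \sum_(m < N) a n * a m * cos ((n%:R - m%:R) * theta f).
Proof.
rewrite /q !expr2 !big_distrlr -big_split; apply: eq_bigr => n _ /=.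
rewrite -big_split; apply: eq_bigr => m _ /=.
rewrite mulrBl cosB; ring.
Qed.

Let integrable_term (n m : nat) :
  mu.-integrable [set: R] (EFin \o (fun f => G f * cos ((n%:R - m%:R) * theta f))).
Proof.
apply: (@integrable_rc_spectrumM _ 1).
  by apply: cont_theta; exact: continuous_cos.
by move=> f; rewrite ler_norml cos_geN1 cos_le1.
Qed.

Lemma rc_sample_quadE :
  \sum_(n < N) \sum_(m < N) a n * a m * rc_sample beta T delta (n%:Z - m%:Z) =
  \int[mu]_f (G f * q f).
Proof.
have -> : \int[mu]_f (G f * q f) =
  \int[mu]_f (\sum_(k : 'I_N * 'I_N)
     (a k.1 * a k.2) * (G f * cos ((k.1%:R - k.2%:R) * theta f))).
  apply: eq_Rintegral => f _; rewrite qE pair_big mulr_sumr.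
  by apply: eq_bigr => k _; rewrite mulrCA.
rewrite Rintegral_sum //; last first.
  move=> k; have := integrableZl measurableT (a k.1 * a k.2) (integrable_term k.1 k.2).
  by [].
rewrite pair_big; apply: eq_bigr => k _ /=.
rewrite RintegralZl //; congr (_ * _); apply: eq_Rintegral => f _.
congr (_ * cos _); rewrite /theta rmorphB /= -!pmulrn; ring.
Qed.

(* (sum a_n cos (n t))^2 + (sum a_n sin (n t))^2 = |p (e^(i t))|^2 for the
   polynomial p with coefficients a, so it has finitely many zeros t. *)
Lemma finite_trig_zeros : (exists n, a n != 0) ->
  finite_set [set f | f \in `[0, (2 * T)^-1]%R /\ q f = 0].
Proof.
move=> [n0 an0]; set Z := [set f | _].
pose z f := (cos (theta f) +i* sin (theta f))%C.
have zX f n : z f ^+ n = (cos (n%:R * theta f) +i* sin (n%:R * theta f))%C.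
  elim: n => [|n IH]; first by rewrite expr0 mul0r cos0 sin0.
  rewrite exprS IH -natr1 mulrDl mul1r addrC cosD sinD /z.
  by apply/eqP; rewrite eq_complex /=; apply/andP; split; apply/eqP; ring.
pose p : {poly R[i]} := \sum_(n < N) ((a n)%:C)%C *: 'X^n.
have p0 : p != 0.
  apply: contraNneq an0 => /(congr1 (fun r : {poly R[i]} => r`_n0)).
  rewrite coef0 coef_sum (bigD1 n0) //= coefZ coefXn eqxx mulr1 big1 ?addr0.
    by move=> /(congr1 (@complex.Re _)) /= ->.
  move=> n nn0; rewrite coefZ coefXn.
  by have /negPf -> : (n0 : nat) != n; rewrite ?mulr0 // eq_sym.
have zroot f : Z f -> root p (z f).
  move=> [_ /eqP]; rewrite /q paddr_eq0 ?sqr_ge0 // !sqrf_eq0 => /andP[/eqP c0 /eqP s0].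
  rewrite rootE horner_sum.
  under eq_bigr do rewrite hornerZ hornerXn zX.
  have -> : \sum_(n < N) (a n)%:C%C * (cos (n%:R * theta f) +i* sin (n%:R * theta f))%C
    = ((\sum_(n < N) a n * cos (n%:R * theta f)) +i*
       (\sum_(n < N) a n * sin (n%:R * theta f)))%C.
    elim/big_ind3: _ => // [x1 x2 x3 y1 y2 y3 -> ->|n _] //.
    by apply/eqP; rewrite eq_complex /= !mul0r subr0 addr0 !eqxx.
  by rewrite c0 s0.
(* Since [delta <= 1], [theta] maps [[0, 1/(2T)]] into [[0, pi]], where the cosine is injective;
   hence the restriction to nonnegative frequencies. *)
have zinj : {in Z &, injective z}.
  move=> f g; rewrite !inE => -[fI _] [gI _] /(congr1 (@complex.Re _)) /=.
  have [d0 d1] := andP delta01.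
  have thI h : h \in `[0, (2 * T)^-1]%R -> theta h \in `[0, pi]%R.
    rewrite !in_itv /= => /andP[h0 h1].
    have c0 : 0 <= 2 * pi * (delta * T) by rewrite !mulr_ge0 ?pi_ge0 ?(ltW d0) ?(ltW T0).
    rewrite /theta mulrAC; apply/andP; split; first by rewrite mulr_ge0.
    apply: le_trans (ler_wpM2l c0 h1) _.
    have -> : 2 * pi * (delta * T) / (2 * T) = delta * pi.
      by field; rewrite gt_eqF.
    by rewrite ler_piMl ?pi_ge0.
  move=> /(cos_inj (thI _ fI) (thI _ gI)); rewrite /theta.
  have dT0 : delta * T != 0 by rewrite gt_eqF // mulr_gt0.
  have pi20 : 2 * pi != 0 :> R by rewrite gt_eqF // mulr_gt0 ?pi_gt0.
  by move=> /(mulIf dT0) /(mulfI pi20).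
(* Infinitely many zeros would give [size p] distinct roots of [p], one more than its degree
   allows. *)
apply: contrapT => /(infinite_set_fset (size p)) [B BZ]; apply/negP; rewrite -ltnNge.
have -> : size (finmap.enum_fset B) = size (map z (finmap.enum_fset B)) by rewrite size_map.
apply: max_poly_roots => //.
  apply/allP => _ /mapP[f fB ->]; apply: zroot; exact: BZ.
rewrite map_inj_in_uniq ?finmap.fset_uniq // => f g fB gB.
by apply: zinj; rewrite inE; apply: BZ.
Qed.

Let integrable_Gq : mu.-integrable [set: R] (EFin \o (fun f => G f * q f)).
Proof.
have iF (k : 'I_N * 'I_N) := integrableZl measurableT (a k.1 * a k.2) (integrable_term k.1 k.2).
apply: eq_integrable (integrable_sum measurableT (index_enum _) (fun k _ => iF k)) => // f _.
rewrite /= qE pair_big mulr_sumr -sumEFin.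
by apply: eq_bigr => k _; rewrite -EFinM mulrCA.
Qed.

Let q_ge0 f : 0 <= q f. Proof. by rewrite addr_ge0 ?sqr_ge0. Qed.

Lemma rc_sample_quad_ge0 :
  0 <= \sum_(n < N) \sum_(m < N) a n * a m * rc_sample beta T delta (n%:Z - m%:Z).
Proof.
rewrite rc_sample_quadE; apply: Rintegral_ge0 => f _.
by rewrite mulr_ge0 // rc_spectrum_ge0.
Qed.

(** A nonnegative integrand with zero integral vanishes almost everywhere, yet for nonzero [a] it is
    positive on [[0, 1/(2T)]] outside a finite set. *)
Lemma rc_sample_quad_eq0 :
  \sum_(n < N) \sum_(m < N) a n * a m * rc_sample beta T delta (n%:Z - m%:Z) = 0 ->
  forall n, a n = 0.
Proof.
rewrite rc_sample_quadE => I0 n; apply/eqP; apply: contrapT => /negP an0.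
have finZ := finite_trig_zeros (ex_intro _ n an0).
have mGq := measurable_int _ integrable_Gq.
have Gq_ge0 f : 0 <= G f * q f by rewrite mulr_ge0 // rc_spectrum_ge0.
have : (\int[mu]_f `|(EFin \o (fun f => (G f * q f)%R)) f|)%E = 0%E.
  under eq_integral do rewrite gee0_abs ?lee_fin //.
  by rewrite -[LHS]fineK ?(integrable_fin_num measurableT integrable_Gq) // [fine _]I0.
move=> /(ae_eq_integral_abs mu measurableT mGq) [A [mA A0 subA]].
set I : set R := `[0, (2 * T)^-1]; pose Z := [set f | f \in `[0, (2 * T)^-1]%R /\ q f = 0].
have T20 : 0 < (2 * T)^-1 by rewrite invr_gt0 mulr_gt0.
(* The interval is covered by two null sets, which contradicts its positive length. *)
have subI : I `<=` A `|` Z.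
  move=> f fI; have [q0|q0] := eqVneq (q f) 0; first by right.
  left; apply: subA => /(_ Logic.I) /eqP; rewrite /= eqe mulf_eq0 (negPf q0) orbF.
  rewrite gt_eqF //; apply: rc_spectrum_gt0 => //.
  by move: fI; rewrite /I /= in_itv /= => /andP[f0 f1]; rewrite ger0_norm.
have mZ : measurable Z by apply: countable_measurable => //; exact: finite_set_countable.
have Z0 : mu Z = 0 by apply: countable_lebesgue_measure0; exact: finite_set_countable.
have : (mu I <= 0)%E.
  rewrite -A0 -[leRHS]adde0 -Z0.
  apply: le_trans (measureU2 _ mA mZ).
  by apply: le_measure => //; rewrite inE; [exact: measurable_itv|exact: measurableU].
by rewrite /= lebesgue_measure_itv /= lte_fin T20 -EFinB subr0 lee_fin leNgt T20.
Qed.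

End Quadratic.

Lemma rc_sampleN (k : int) : rc_sample beta T delta (- k) = rc_sample beta T delta k.
Proof.
apply: eq_Rintegral => f _; congr (_ * _); rewrite -[RHS]cosN; congr cos.
by rewrite rmorphN /=; ring.
Qed.

Lemma GN_quadE N (v : 'cV[R[i]]_N) : (v ^t* *m GN beta T delta N *m v) 0 0 =
  ((\sum_(n < N) \sum_(m < N) complex.Re (v n 0) * complex.Re (v m 0) *
     rc_sample beta T delta (n%:Z - m%:Z) +
   \sum_(n < N) \sum_(m < N) complex.Im (v n 0) * complex.Im (v m 0) *
     rc_sample beta T delta (n%:Z - m%:Z))%:C)%C.
Proof.
pose g (n m : 'I_N) := rc_sample beta T delta (n%:Z - m%:Z).
have E : (v ^t* *m GN beta T delta N *m v) 0 0 =
    \sum_n \sum_m ((v n 0)^* * v m 0 * (g n m)%:C)%C.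
  rewrite mxE exchange_big; apply: eq_bigr => m _ /=.
  rewrite mxE mulr_suml; apply: eq_bigr => n _; rewrite !mxE.
  by rewrite mulrAC.
have E' : (v ^t* *m GN beta T delta N *m v) 0 0 =
    \sum_n \sum_m ((v m 0)^* * v n 0 * (g n m)%:C)%C.
  rewrite E exchange_big; apply: eq_bigr => m _; apply: eq_bigr => n _ /=.
  by rewrite /g -rc_sampleN opprB.
(* Adding the form to its copy with [n] and [m] exchanged cancels the mixed terms between real and
   imaginary parts. *)
apply: (mulfI (_ : 2 != 0)); first by rewrite pnatr_eq0.
rewrite mulr_natl mulr2n {1}E E' -big_split -big_split /=.
rewrite rmorph_sum mulr_sumr; apply: eq_bigr => n _ /=.
rewrite -!big_split rmorph_sum mulr_sumr; apply: eq_bigr => m _ /=.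
rewrite -/(g n m); case: (v n 0) (v m 0) (g n m) => [x1 y1] [x2 y2] r.
by apply/eqP; rewrite eq_complex /=; apply/andP; split; apply/eqP; ring.
Qed.

Lemma psd_GN N : psd (GN beta T delta N).
Proof.
split.
  apply/matrixP => n m; rewrite !mxE -rc_sampleN opprB.
  by apply/eqP; rewrite eq_complex /= oppr0 !eqxx.
move=> v; rewrite GN_quadE lecR.
exact: addr_ge0 (rc_sample_quad_ge0 _) (rc_sample_quad_ge0 _).
Qed.

(** A kernel vector annihilates the quadratic form, so its real and imaginary parts vanish
    separately by definiteness. *)
Lemma GN_unit N : GN beta T delta N \in unitmx.
Proof.
rewrite unitmxE unitfE; apply/det0P => -[u u0 uG].
have : ((u ^t*) ^t* *m GN beta T delta N *m u ^t*) 0 0 = 0.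
  by rewrite trmxCK uG mul0mx mxE.
rewrite GN_quadE => /(congr1 (@complex.Re _)) /= /eqP.
rewrite paddr_eq0 ?rc_sample_quad_ge0 // => /andP[/eqP/rc_sample_quad_eq0 re0].
move=> /eqP/rc_sample_quad_eq0 im0; case/negP: u0; apply/eqP.
rewrite -[u]trmxCK; suff -> : u ^t* = 0 by rewrite trmx0 map_mx0.
apply/matrixP => n j; rewrite [j]ord1 [RHS]mxE; apply/eqP.
by rewrite eq_complex re0 im0 !eqxx.
Qed.

End Pulse.

(** * Eigenvalues, logarithms and the capacity for a fixed block length *)

Lemma char_poly_conj_diag (F : comNzRingType) n (V U : 'M[F]_n) (d : 'rV[F]_n) :
  V *m U = 1%:M -> char_poly (V *m diag_mx d *m U) = \prod_i ('X - (d 0 i)%:P).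
Proof.
move=> VU; have VU' : map_mx polyC V *m map_mx polyC U = 1%:M.
  by rewrite -map_mxM VU map_mx1.
have -> : char_poly (V *m diag_mx d *m U) = char_poly (diag_mx d).
  rewrite /char_poly /char_poly_mx.
  have -> : 'X%:M - map_mx polyC (V *m diag_mx d *m U) =
      map_mx polyC V *m ('X%:M - map_mx polyC (diag_mx d)) *m map_mx polyC U.
    by rewrite mulmxBr mulmxBl scalar_mxC -[_%:M *m _ *m _]mulmxA VU' mulmx1 !map_mxM.
  by rewrite !det_mulmx mulrAC -det_mulmx VU' det1 mul1r.
rewrite char_poly_trig; last exact: diag_mx_is_trig.
by apply: eq_bigr => i _; rewrite mxE eqxx.
Qed.

Section Capacity.
Variable R : realType.

Lemma ln_prod (I : Type) (r : seq I) (y : I -> R) : (forall i, 0 < y i) ->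
  ln (\prod_(i <- r) y i) = \sum_(i <- r) ln (y i).
Proof.
move=> y0; elim: r => [|i r IH]; first by rewrite !big_nil ln1.
by rewrite !big_cons lnM ?IH // posrE // prodr_gt0.
Qed.

Lemma log2_prodX N L (y : 'I_L -> R) : (0 < N)%N -> (forall i, 0 < y i) ->
  N%:R^-1 * log2 (\prod_i y i ^+ N) = \sum_i log2 (y i).
Proof.
move=> N0 y0; rewrite /log2 ln_prod => [|i]; last exact: exprn_gt0.
rewrite -mulr_suml mulrA; congr (_ * _); rewrite mulr_sumr; apply: eq_bigr => i _.
by rewrite lnXn // -[ln _ *+ _]mulr_natl mulKf // pnatr_eq0 -lt0n.
Qed.

Lemma le_log2 (x y : R) : 1 <= y -> x <= y -> log2 x <= log2 y.
Proof.
move=> y1 xy; have l2 : 0 < ln 2 :> R by rewrite ln_gt0 // ltr1n.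
rewrite /log2 ler_pM2r ?invr_gt0 //.
(* [ln] takes the default value 0 at nonpositive arguments; [1 <= y] keeps the inequality true
   there. *)
have [x0|x0] := leP x 0; first by rewrite ln0 // ln_ge0.
by rewrite ler_ln ?posrE // (lt_le_trans _ xy).
Qed.

Lemma wf_pos_ge0 (mu tau : R) : 0 <= wf_pos mu tau.
Proof. by rewrite /wf_pos; case: ifP => // _; rewrite le_max lexx orbT. Qed.

(** Either the channel is inactive, with [tau <= mu] and zero power, or it is active and
    [mu * (1 + wf_pos mu tau * tau)] is exactly [tau]. *)
Lemma wf_pos_kkt (mu tau : R) : 0 < mu -> 0 <= tau ->
  tau <= mu * (1 + wf_pos mu tau * tau) /\
  tau * wf_pos mu tau = mu * (1 + wf_pos mu tau * tau) * wf_pos mu tau.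
Proof.
move=> mu0 tau0; rewrite /wf_pos; case: eqVneq => [->|tauN0].
  by rewrite !mul0r addr0 mulr1 mulr0; split => //; exact: ltW.
have tau1 : 0 < tau by rewrite lt_neqAle eq_sym tauN0.
have [h|h] := leP (mu^-1 - tau^-1) 0.
  rewrite mul0r addr0 !mulr0 mulr1; split => //.
  by move: h; rewrite subr_le0 lef_pV2.
have -> : mu * (1 + (mu^-1 - tau^-1) * tau) = tau.
  by field; rewrite tauN0 gt_eqF.
by [].
Qed.

Variables (K L : nat) (H : 'M[R[i]]_(K, L)) (U : 'M[R[i]]_L) (tau : 'I_L -> R).
Variables (beta T delta sigma2 P mu : R).
Hypotheses (beta01 : 0 <= beta <= 1) (T0 : 0 < T) (delta01 : 0 < delta <= 1).
Hypotheses (s0 : 0 < sigma2) (mu0 : 0 < mu).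
Hypothesis UU : U *m U ^t* = 1%:M.
Hypothesis HH : H ^t* *m H = U ^t* *m diag_mx (\row_i (tau i)%:C%C) *m U.
Hypothesis tau0 : forall i, 0 <= tau i.
Hypothesis wf_eq : sigma2 * (\sum_(i < L) wf_pos mu (tau i)) = P * delta * T.

Let alpha i := sigma2 * wf_pos mu (tau i).
Let y i := 1 + sigma2^-1 * alpha i * tau i.

Let alpha0 i : 0 <= alpha i.
Proof. by rewrite mulr_ge0 ?wf_pos_ge0 // ltW. Qed.

Let y1 i : 1 <= y i.
Proof. by rewrite lerDl !mulr_ge0 ?invr_ge0 ?wf_pos_ge0 ?(ltW s0). Qed.

Let yC i : 1 + (sigma2%:C%C)^-1 * (alpha i)%:C%C * (tau i)%:C%C = (y i)%:C%C.
Proof. by rewrite rmorphD rmorph1 !rmorphM fmorphV. Qed.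

Let prod_yC N : \prod_i (y i)%:C%C ^+ N = (\prod_i y i ^+ N)%:C%C.
Proof. by rewrite rmorph_prod; apply: eq_bigr => i _; rewrite rmorphXn. Qed.

Let yE i : y i = 1 + wf_pos mu (tau i) * tau i.
Proof. by rewrite /y /alpha mulKf // gt_eqF. Qed.

Let kkt_le i : (tau i)%:C%C <= mu%:C%C *
  (1 + (sigma2%:C%C)^-1 * (alpha i)%:C%C * (tau i)%:C%C).
Proof. by rewrite yC -rmorphM lecR yE; have [] := wf_pos_kkt mu0 (tau0 i). Qed.

Let kkt_eq i : (tau i)%:C%C * (alpha i)%:C%C = mu%:C%C *
  (1 + (sigma2%:C%C)^-1 * (alpha i)%:C%C * (tau i)%:C%C) * (alpha i)%:C%C.
Proof.
rewrite yC -!rmorphM yE /alpha; congr (_%:C%C).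
have [_ E] := wf_pos_kkt mu0 (tau0 i).
by rewrite mulrCA E mulrCA.
Qed.

Let sum_alphaC : \sum_i (alpha i)%:C%C = (P * delta * T)%:C%C.
Proof. by rewrite -wf_eq mulr_sumr rmorph_sum. Qed.

Let powerE N : N%:R * (P * delta * T)%:C%C = (N%:R * delta * T)%:C%C * P%:C%C.
Proof.
rewrite -[N%:R](rmorph_nat (real_complex R)) -!rmorphM; congr (_%:C%C).
by ring.
Qed.

Lemma ftn_cap_N_eq N : (0 < N)%N ->
  ftn_cap_N N H beta T delta sigma2 P = (\sum_(i < L) log2 (y i))%:E.
Proof.
move=> N0; have [d0 _] := andP delta01.
have [B GE] := psd_gram_exists (psd_GN beta01 T0 delta N).
have Gu := GN_unit beta01 T0 delta01 N.
have sC0 : 0 < sigma2%:C%C by rewrite ltcR.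
have muC0 : 0 <= mu%:C%C by rewrite lecR ltW.
have tauC0 i : 0 <= (tau i)%:C%C by rewrite lecR.
have alphaC0 i : 0 <= (alpha i)%:C%C by rewrite lecR.
have NdT0 : 0 < (N%:R * delta * T)%:C%C by rewrite ltcR !mulr_gt0 ?ltr0n.
have yE2 : \prod_i (1 + (sigma2%:C%C)^-1 * (alpha i)%:C%C * (tau i)%:C%C) ^+ N =
    (\prod_i y i ^+ N)%:C%C.
  by rewrite -prod_yC; apply: eq_bigr => i _; rewrite yC.
have y0 i : 0 < y i by rewrite (lt_le_trans ltr01).
apply/eqP; rewrite eq_le; apply/andP; split.
  apply: ge_ereal_sup => _ [SA [psdSA powSA] <-].
  rewrite lee_fin -(log2_prodX N0 y0) /ftn_rate ler_wpM2l ?invr_ge0 //.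
  apply: le_log2.
    by apply: (big_ind (fun x : R => 1 <= x)) => [||i _];
      [exact: lexx|exact: mulr_ege1|exact: exprn_ege1].
  have trSA : \tr ((1%:M *t GN beta T delta N) *m SA) <= N%:R * \sum_i (alpha i)%:C%C.
    by rewrite sum_alphaC powerE; move: powSA; rewrite ler_pdivrMl.
  have := det_ratio_le sC0 tauC0 UU HH GE Gu alphaC0 muC0 kkt_le kkt_eq psdSA trSA.
  (* The order on [R[i]] compares real parts and requires equal imaginary parts, so the bound passes
     to the real part used in the rate. *)
  by rewrite yE2 lecE => /andP[].
have [SA [psdSA powSA ratioE]] := det_ratio_attained sC0 tauC0 UU HH GE Gu alphaC0.
apply: ereal_sup_ubound; exists SA.
  by split => //; rewrite powSA sum_alphaC powerE mulKf // gt_eqF.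
by rewrite /ftn_rate ratioE yE2 /= log2_prodX.
Qed.

End Capacity.

(** * Matching the given eigenvalues with a diagonalization, and the limit *)

Theorem theorem1 (R : realType) (K L : nat) (H : 'M[R[i]]_(K, L))
    (beta T delta sigma2 P : R) (tau : 'I_L -> R) (mu : R) :
  0 <= beta <= 1 -> 0 < T -> 0 < delta <= 1 -> 0 < sigma2 -> 0 < P ->
  (* tau_1, ..., tau_L are the eigenvalues (with multiplicity) of H^dagger H *)
  char_poly (H ^t* *m H) = \prod_(i < L) ('X - ((tau i)%:C%C)%:P) ->
  (* mu > 0 solves the water-filling equation *)
  0 < mu -> sigma2 * (\sum_(i < L) wf_pos mu (tau i)) = P * delta * T ->
  1 <= delta * (1 + beta) ->
  let alpha := fun i : 'I_L => sigma2 * wf_pos mu (tau i) in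
  let C := \sum_(i < L) log2 (1 + sigma2^-1 * alpha i * tau i) in
  (* capacity in bits per channel use *)
  ((fun N : nat => @ftn_cap_N R K L N H beta T delta sigma2 P) @ \oo --> (C%:E : \bar R))
  /\
  (* capacity in bit/s/Hz: C / (delta (1 + beta)) *)
  ((fun N : nat => @ftn_cap_N R K L N H beta T delta sigma2 P * ((delta * (1 + beta))^-1)%:E)%E
     @ \oo -->
   (((delta * (1 + beta))^-1 * \sum_(i < L) log2 (1 + sigma2^-1 * alpha i * tau i))%:E
     : \bar R)).
Proof.
move=> beta01 T0 delta01 s0 P0 charH mu0 wf_eq _ alpha C.
have psdHH : psdmx (H ^t* *m H) by have := psd_gram (H ^t*); rewrite trmxCK.
have [U [d [UU U'U d0 HH]]] := psd_spectral psdHH.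
pose tau' i := complex.Re (d 0 i).
have tau'E i : (tau' i)%:C%C = d 0 i by rewrite RRe_real // ger0_real.
have tau'0 i : 0 <= tau' i by rewrite -lecR tau'E.
(* Two factorizations of one characteristic polynomial have the same roots up to order; sums over
   the eigenvalues, all that the water-filling equation and the capacity use, are unaffected. *)
have perm_tau : perm_eq [seq (tau i)%:C%C | i <- index_enum 'I_L]
    [seq d 0 i | i <- index_enum 'I_L].
  apply: prod_XsubC_eq; rewrite !big_map -charH {1}HH /=.
  exact: char_poly_conj_diag.
have sum_tau (f : R -> R) : \sum_i f (tau i) = \sum_i f (tau' i).
  have := perm_big (op := +%R) (x := 0) (P := xpredT) (F := f \o @complex.Re R) _ perm_tau.
  by rewrite !big_map.
have HH' : H ^t* *m H = U ^t* *m diag_mx (\row_i (tau' i)%:C%C) *m U.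
  by rewrite HH; congr (_ *m diag_mx _ *m _); apply/rowP => i; rewrite mxE tau'E.
rewrite (sum_tau (wf_pos mu)) in wf_eq.
have capE N : (0 < N)%N -> ftn_cap_N N H beta T delta sigma2 P = C%:E.
  move=> N0; rewrite (ftn_cap_N_eq beta01 T0 delta01 s0 mu0 UU HH' tau'0 wf_eq N0).
  by rewrite /C /alpha (sum_tau (fun t => log2 (1 + sigma2^-1 * (sigma2 * wf_pos mu t) * t))).
(* The sequences are constant from [N = 1] on; [N = 0] is left out because the rate divides by
   [N]. *)
split; apply: cvg_near_cst; exists 1%N => // N /= N0; rewrite capE //.
by rewrite -EFinM mulrC.
Qed.
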